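(* Let $k$ be an infinite field of characteristic $p>0$, let $n\ge 5$, let $q=p^e$ ($e\ge 0$) be a power of $p$, and for $i=1,\ldots,n+1$ let $d_i=k_iq+r_i$ with integers $1\le k_i\le p-1$, $0\le r_i\le q-1$ such that $$k_i\le\left\lfloor\frac{\sum_{j=1}^{n+1}k_j-n+1}{2}\right\rfloor\quad\text{for all } i\in\{1,\ldots,n+1\}.$$ If the ring $A=k[x_1,\ldots,x_{n+1}]/(x_1^{d_1},\ldots,x_{n+1}^{d_{n+1}})$ has the weak Lefschetz property, then $q=1$.
   Context: A standard graded algebra $A=\oplus_i A_i$ has the weak Lefschetz property (WLP) if there exists $L\in A_1$ such that the multiplication map $\times L:A_i\to A_{i+1}$ has maximal rank (i.e. is injective or surjective) for every $i$. *)

(* Defs.v *)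
From HB Require Import structures.
From mathcomp Require Import all_boot all_order all_algebra.
From mathcomp Require Import boolp.
From mathcomp Require classical_sets cardinality.
From mathcomp Require Import mpoly.

Set Implicit Arguments.
Unset Strict Implicit.
Unset Printing Implicit Defensive.

Import GRing.Theory.
Local Open Scope ring_scope.
Local Open Scope quotient_scope.

(* The ideal (g_i)_{i : I}. It may be the unit ideal, so it is not given an
   [idealr] structure, and R / (g_i) below is only a [comPzRingType]. *)
Section GeneratedIdeal.
Variables (R : comNzRingType) (I : finType) (g : I -> R).

Definition gen_ideal : {pred R} :=
  fun f => `[< exists c : I -> R, f = \sum_i c i * g i >].

Lemma gen_idealP f :
  reflect (exists c : I -> R, f = \sum_i c i * g i) (f \in gen_ideal).
Proof. exact: asboolP. Qed.

Lemma gen_ideal_zmod_closed : zmod_closed gen_ideal.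
Proof.
split=> [|x y /gen_idealP[a ->] /gen_idealP[b ->]]; apply/gen_idealP.
  by exists (fun=> 0); rewrite big1 // => i _; rewrite mul0r.
exists (fun i => a i - b i); rewrite -sumrB.
by apply: eq_bigr => i _; rewrite mulrBl.
Qed.

HB.instance Definition _ :=
  GRing.isZmodClosed.Build R gen_ideal gen_ideal_zmod_closed.

Lemma gen_idealMl a f : f \in gen_ideal -> a * f \in gen_ideal.
Proof.
move=> /gen_idealP[c ->]; apply/gen_idealP; exists (fun i => a * c i).
by rewrite mulr_sumr; apply: eq_bigr => i _; rewrite mulrA.
Qed.

Definition gen_quot : Type := {ideal_quot gen_ideal}.

HB.instance Definition _ := GRing.Zmodule.on gen_quot.
HB.instance Definition _ := ZmodQuotient.on gen_quot.

Lemma gen_quot_eqP x y :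
  reflect (\pi_gen_quot x = \pi_gen_quot y) (x - y \in gen_ideal).
Proof. by rewrite Quotient.idealrBE; apply: eqP. Qed.

Definition gen_quot_one : gen_quot := lift_cst gen_quot 1.
Definition gen_quot_mul := lift_op2 gen_quot *%R.

Fact gen_quot_pi1 : \pi_gen_quot 1 = gen_quot_one.
Proof. by unlock gen_quot_one. Qed.

Fact gen_quot_piM x y :
  \pi_gen_quot (x * y) = gen_quot_mul (\pi_gen_quot x) (\pi_gen_quot y).
Proof.
unlock gen_quot_mul.
have rK z : z - repr (\pi_gen_quot z) \in gen_ideal.
  by apply/gen_quot_eqP; rewrite reprK.
apply/gen_quot_eqP; set x' := repr _; set y' := repr _.
have -> : x * y - x' * y' = y * (x - x') + x' * (y - y').
  by rewrite !mulrBr [y * x]mulrC [y * x']mulrC addrA subrK.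
by rewrite rpredD // gen_idealMl // rK.
Qed.

Fact gen_quot_mulA : associative gen_quot_mul.
Proof.
by move=> x y z; rewrite -[x]reprK -[y]reprK -[z]reprK -!gen_quot_piM mulrA.
Qed.

Fact gen_quot_mulC : commutative gen_quot_mul.
Proof. by move=> x y; rewrite -[x]reprK -[y]reprK -!gen_quot_piM mulrC. Qed.

Fact gen_quot_mul1 : left_id gen_quot_one gen_quot_mul.
Proof. by move=> x; rewrite -[x]reprK -gen_quot_pi1 -gen_quot_piM mul1r. Qed.

Fact gen_quot_mulDl : left_distributive gen_quot_mul +%R.
Proof.
move=> x y z; rewrite -[x]reprK -[y]reprK -[z]reprK.
by rewrite -!gen_quot_piM -!pi_addr -!gen_quot_piM mulrDl.
Qed.

HB.instance Definition _ := GRing.Zmodule_isComPzRing.Build gen_quot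
  gen_quot_mulA gen_quot_mulC gen_quot_mul1 gen_quot_mulDl.

(* A lemma rather than an instance: the canonical [rmorphism] structure of \pi
   is already taken by the quotients that are [nzRingQuotType]s. *)
Lemma pi_gen_quot_monoid_morphism : monoid_morphism \pi_gen_quot.
Proof. by split=> [|x y]; [exact: gen_quot_pi1 | exact: gen_quot_piM]. Qed.

End GeneratedIdeal.

(* [Agr i] is the degree i component of A. *)
Definition weak_Lefschetz (A : comPzRingType) (Agr : nat -> A -> Prop) : Prop :=
  exists2 L : A, Agr 1%N L & forall i : nat,
    (forall x y, Agr i x -> Agr i y -> L * x = L * y -> x = y) \/
    (forall z, Agr i.+1 z -> exists2 x, Agr i x & L * x = z).

Section MonomialCompleteIntersection.
Variables (k : fieldType) (m : nat) (d : 'I_m -> nat).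

Definition mci : comPzRingType :=
  gen_quot (fun i : 'I_m => 'X_i ^+ d i : {mpoly k[m]}).

Definition mci_degree (i : nat) (x : mci) : Prop :=
  exists2 f : {mpoly k[m]}, f \is i.-homog & \pi_mci f = x.

End MonomialCompleteIntersection.

(* Main.v *)
Require Import Defs.
From HB Require Import structures.
From mathcomp Require Import all_boot all_order all_algebra.
From mathcomp Require Import boolp.
From mathcomp Require classical_sets cardinality.
From mathcomp Require Import mpoly.
From mathcomp Require Import ssrcomplements zify ring.
Local Open Scope ring_scope.

(** Let [f = \sum_i c_i x_i] be a candidate Lefschetz element and let [s] be the
    socle degree [\sum_i (d_i - 1)] of [A]. By Gorenstein duality, multiplication
    by [f] cannot have maximal rank in degree [j] once some nonzero [z] of degree
    [j < s / 2] satisfies [f z = 0] ([kernel_obstruction]). Hence it is enough to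
    find, when [q > 1], a nonzero [w] of low degree killed by a small power of [f]
    ([power_obstruction]): the last nonzero [f^t w] plays the role of [z].

    The Frobenius gives [f^q = \sum_i c_i^q x_i^q], a linear form in the variables
    [y_i = x_i^q]. Kernel elements of a linear form acting on
    [k[y] / (y_i^(e_i + 1))] come from the invariant theory of sl_2. When the [e_i]
    are less than [p], rescaling the monomials by factorials turns multiplication
    by the linear form into the lowering operator on the tensor product of the
    representations Sym^(e_i) ([twist_lowering]), and a product of brackets
    [c_j^q y_j - c_i^q y_i] along the edges of a loopless multigraph with degrees
    [e_i] is annihilated by it ([kernel_form]). Such a multigraph exists as soon as
    [\sum_i e_i = 2N] is even and every [e_i] is at most [N]
    ([loopless_multigraph]). The resulting polynomial in [y] has degree [N], that
    is, it lies in the middle of [k[y] / (y_i^(e_i + 1))].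

    Multiplied by [\prod_i x_i^(off_i)], this polynomial is still killed by [f^q] in
    [A] if [q (e_i + 1) + off_i >= d_i], and it is nonzero in [A] if
    [q e_i + off_i < d_i]. For [d_i = k_i q + r_i] one can take
    [(e_i, off_i) = (k_i - 1, r_i)] or [(k_i, 0)]. With at least six variables and
    [p] odd, [exponent_choice] selects them so that the degree stays below [s / 2]
    after multiplication by [f^(q-1)]; the hypothesis on the [k_i] is what
    gives [e_i <= N]. For [p = 2] all [k_i] are 1, and the last nonzero power of
    [f] itself is the kernel element ([nilpotent_obstruction]). *)

Set Implicit Arguments.
Unset Strict Implicit.
Unset Printing Implicit Defensive.

Import GRing.Theory.

(** * Multigraphs with prescribed degrees *)

(** Listing each vertex [i] exactly [e i] times in sorted order, the positions [t]
    and [t + N] never carry the same vertex, as a run of equal entries has length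
    at most [N]; joining them for every [t < N] gives the multigraph. *)
Lemma loopless_multigraph (m N : nat) (e : 'I_m -> nat) :
  (\sum_i e i = N.*2)%N -> (forall i, e i <= N)%N ->
  exists E : seq ('I_m * 'I_m),
    [/\ size E = N, all (fun x => x.1 != x.2) E &
        forall i, (\sum_(x <- E) ((x.1 == i) + (x.2 == i)) = e i)%N].
Proof.
move=> sum_e le_e.
pose s0 := flatten [seq nseq (e i) i | i <- enum 'I_m].
pose s := sort (relpre val leq) s0.
have cnt i : count_mem i s = e i.
  rewrite (permP (permEl (perm_sort _ s0))) count_flatten -map_comp sumnE big_map.
  rewrite big_enum /= (bigD1 i) //= count_nseq /= eqxx mul1n big1 ?addn0 // => j.
  by rewrite count_nseq /= => /negPf->.
have sz : size s = (N + N)%N.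
  rewrite size_sort size_flatten /shape -map_comp sumnE big_map big_enum /=.
  by rewrite addnn -sum_e; apply: eq_bigr => i _; rewrite size_nseq.
have sz1 : size (take N s) = N by rewrite size_takel // sz leq_addr.
have sz2 : size (drop N s) = N by rewrite size_drop sz addnK.
have srt : sorted (relpre val leq) s by apply: sort_sorted => x y; apply: leq_total.
exists (zip (take N s) (drop N s)); split.
- by rewrite size1_zip sz1 ?sz2.
- apply/allP => -[x y] /(nthP (x, x)) [t]; rewrite size1_zip ?sz1 ?sz2 // => ltN.
  rewrite nth_zip ?sz1 ?sz2 //= => -[xE yE]; apply/eqP => xy; move: yE.
  rewrite -xy nth_drop => yE; move: xE; rewrite nth_take // => xE.
  (* By sortedness, a loop would force N + 1 consecutive entries equal to [x]. *)
  have constant_run j : (t <= j <= N + t)%N -> nth x s j = x.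
    case/andP=> tj jN; apply/val_inj/eqP; rewrite eqn_leq.
    have tr : transitive (relpre (val : 'I_m -> nat) leq).
      by move=> a b c; apply: leq_trans.
    have nthle a b : (a <= b)%N -> (b < size s)%N -> (nth x s a <= nth x s b)%N.
      move=> ab bs; apply: (sorted_leq_nth tr _ x srt) => //.
        by rewrite inE (leq_ltn_trans ab).
    have -> : (nth x s j <= x)%N.
      by rewrite -[X in (_ <= val X)%N]yE nthle // sz ltn_add2l.
    rewrite -[X in (val X <= _)%N]xE.
    by rewrite nthle ?sz ?(leq_ltn_trans jN) ?ltn_add2l ?andbT //.
  have : (N.+1 <= count_mem x s)%N.
    rewrite -{1}(cat_take_drop t s) count_cat.
    apply: leq_trans (leq_addl _ _).
    rewrite -(cat_take_drop N.+1 (drop t s)) count_cat.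
    apply: leq_trans (leq_addr _ _).
    have szt : size (take N.+1 (drop t s)) = N.+1.
      by rewrite size_takel // size_drop sz; lia.
    rewrite -{1}szt; apply: eq_leq; apply/esym/eqP; rewrite -all_count.
    apply/(all_nthP x) => j; rewrite szt => jN /=.
    by rewrite nth_take // nth_drop constant_run //; lia.
  by rewrite cnt ltnNge le_e.
- move=> i; have -> : e i = (count_mem i (take N s) + count_mem i (drop N s))%N.
    by rewrite -cnt -count_cat cat_take_drop.
  rewrite big_split /=; congr (_ + _)%N.
    rewrite -[in RHS](unzip1_zip (s := take N s) (t := drop N s)) ?sz1 ?sz2 //.
    by rewrite count_map -sum1_count [RHS]big_mkcond; apply: eq_bigr => x _ /=; case: eqP.
  rewrite -[in RHS](unzip2_zip (s := take N s) (t := drop N s)) ?sz1 ?sz2 //.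
  by rewrite count_map -sum1_count [RHS]big_mkcond; apply: eq_bigr => x _ /=; case: eqP.
Qed.

(** * Invariants from brackets *)

Section KernelForm.
Variables (k : fieldType) (m : nat) (g : 'I_m -> k).
Implicit Types (p : {mpoly k[m]}) (x : 'I_m * 'I_m) (E : seq ('I_m * 'I_m)).

(** The derivation [\sum_i g_i x_i^2 d/dx_i], the quadratic part of the lowering
    operator of sl_2 in an affine coordinate on each factor. *)
Definition quadratic_field p := \sum_i g i *: ('X_i ^+ 2 * p^`M(i)).

Lemma quadratic_fieldM p1 p2 :
  quadratic_field (p1 * p2) = quadratic_field p1 * p2 + p1 * quadratic_field p2.
Proof.
rewrite /quadratic_field mulr_suml mulr_sumr -big_split /=; apply: eq_bigr => i _.
by rewrite mderivM -scalerAl -scalerAr -scalerDr; congr (_ *: _); ring.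
Qed.

Lemma quadratic_field1 : quadratic_field 1 = 0.
Proof. by rewrite /quadratic_field big1 // => i _; rewrite mderivC mulr0 scaler0. Qed.

Lemma quadratic_fieldX i : quadratic_field 'X_i = g i *: 'X_i ^+ 2.
Proof.
rewrite /quadratic_field (bigD1 i) //= big1 => [|j nji].
  by rewrite mderivX mnm1E eqxx scale1r -{2}(add0m U_(i)%MM) addmK mpolyX0 mulr1 addr0.
by rewrite mderivX mnm1E eq_sym (negPf nji) scale0r mulr0 scaler0.
Qed.

Lemma quadratic_fieldB p1 p2 :
  quadratic_field (p1 - p2) = quadratic_field p1 - quadratic_field p2.
Proof.
rewrite /quadratic_field -sumrB; apply: eq_bigr => i _.
by rewrite mderivB mulrBr scalerBr.
Qed.

Lemma quadratic_fieldZ c p : quadratic_field (c *: p) = c *: quadratic_field p.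
Proof.
rewrite /quadratic_field scaler_sumr; apply: eq_bigr => i _.
by rewrite mderivZ -scalerAr !scalerA mulrC.
Qed.

(** The sl_2-invariant bracket of two factors. When both weights vanish so does the
    bracket, but [quadratic_field] then kills either variable, which can take its
    place; this is what allows linear forms with zero coefficients. *)
Definition edge_form x : {mpoly k[m]} :=
  if (g x.1 == 0) && (g x.2 == 0) then 'X_x.1
  else g x.2 *: 'X_x.2 - g x.1 *: 'X_x.1.

(** Each bracket divides its image, and the cofactor is the sum of its two weighted
    variables, since [b^2 - a^2 = (b - a) (a + b)]. *)
Lemma quadratic_field_edge x :
  quadratic_field (edge_form x) =
    edge_form x * (g x.1 *: 'X_x.1 + g x.2 *: 'X_x.2).
Proof.
rewrite /edge_form; case: ifP => [/andP[/eqP g1 /eqP g2]|_].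
  by rewrite quadratic_fieldX g1 g2 !scale0r addr0 mulr0.
rewrite quadratic_fieldB !quadratic_fieldZ !quadratic_fieldX -!mul_mpolyC; ring.
Qed.

Lemma edge_form_neq0 x : x.1 != x.2 -> edge_form x != 0.
Proof.
move=> n12; apply/eqP => /(congr1 (fun p => (p@_U_(x.1), p@_U_(x.2)))).
rewrite /edge_form; case: ifP => [_|/negP n0] [].
  by rewrite mcoeffXU mcoeff0 eqxx => /eqP; rewrite oner_eq0.
rewrite !mcoeff0 !mcoeffB !mcoeffZ !mcoeffXU !eqxx [x.2 == x.1]eq_sym (negPf n12).
rewrite !(mulr0, mulr1, subr0, sub0r) => /eqP; rewrite oppr_eq0 => g1 g2.
by case: n0; rewrite g1 g2 eqxx.
Qed.

Lemma edge_form_homog x : edge_form x \is 1.-homog.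
Proof.
rewrite /edge_form; have hX i : ('X_i : {mpoly k[m]}) \is 1.-homog.
  by rewrite dhomogX; apply/eqP; apply: mdeg1.
by case: ifP => // _; rewrite rpredB ?rpredZ.
Qed.

Lemma msupp_edge_form x a i : a \in msupp (edge_form x) ->
  (a i <= (x.1 == i) + (x.2 == i))%N.
Proof.
have hX j (b : 'X_{1..m}) : b \in msupp ('X_j : {mpoly k[m]}) -> (b i <= (j == i))%N.
  by rewrite msuppX inE => /eqP->; rewrite mnm1E.
rewrite /edge_form; case: ifP => [_ /hX|_]; first by lia.
by move/msuppB_le; rewrite mem_cat => /orP[] /msuppZ_le/hX; lia.
Qed.

(** Classical invariant theory: the product of brackets along a multigraph with
    degrees [e] is an invariant of the tensor product of the Sym^(e_i). Cofactors
    add up along the product by the Leibniz rule, and each variable [x_i] appears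
    in [e i] of them. *)
Lemma kernel_form N (e : 'I_m -> nat) :
  (\sum_i e i = N.*2)%N -> (forall i, e i <= N)%N ->
  exists P : {mpoly k[m]},
    [/\ P != 0, P \is N.-homog, forall a, a \in msupp P -> forall i, (a i <= e i)%N &
        quadratic_field P = (\sum_i (g i *: 'X_i) *+ e i) * P].
Proof.
move=> sum_e le_e; have [E [szE noloop degE]] := loopless_multigraph sum_e le_e.
exists (\prod_(x <- E) edge_form x); split.
- rewrite prodf_seq_neq0; apply/allP => x xE /=; apply: edge_form_neq0.
  exact: (allP noloop).
- rewrite -szE; elim: E {szE noloop degE} => [|x E IH] /=.
    by rewrite big_nil dhomog1.
  by rewrite big_cons -add1n dhomogM ?edge_form_homog.
- move=> a aP i; rewrite -degE; elim: E {szE noloop degE} a aP => [|x E IH] a.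
    by rewrite !big_nil msupp1 inE => /eqP->; rewrite mnm0E.
  rewrite !big_cons => /msuppM_le/allpairsP[[a1 a2] /= [a1x a2E ->]].
  by rewrite mnmDE leq_add ?(msupp_edge_form _ a1x) ?IH.
- have -> : \sum_i (g i *: 'X_i) *+ e i =
      \sum_(x <- E) (g x.1 *: 'X_x.1 + g x.2 *: 'X_x.2) :> {mpoly k[m]}.
    under eq_bigr do rewrite -degE -sumrMnr.
    rewrite exchange_big /=; apply: eq_bigr => x _.
    under eq_bigr do rewrite mulrnDr.
    rewrite big_split /=; congr (_ + _).
      rewrite (bigD1 x.1) //= eqxx mulr1n big1 ?addr0 // => i.
      by rewrite eq_sym => /negPf->.
    rewrite (bigD1 x.2) //= eqxx mulr1n big1 ?addr0 // => i.
    by rewrite eq_sym => /negPf->.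
  elim: E {szE noloop degE} => [|x E IH].
    by rewrite !big_nil quadratic_field1 mul0r.
  rewrite !big_cons quadratic_fieldM IH quadratic_field_edge.
  by rewrite mulrDl mulrA -[_ * _ * \prod_(_ <- _) _]mulrA; ring.
Qed.

End KernelForm.

(** * The monomial complete intersection and obstructions to maximal rank *)

Lemma mcoeffMX_nle (R : ringType) (m : nat) (p : {mpoly R[m]}) (a b : 'X_{1..m}) :
  ~~ (b <= a)%MM -> (p * 'X_[b])@_a = 0.
Proof.
move=> nba; apply/eqP; rewrite mcoeff_eq0 (perm_mem (msuppMX p b)).
by apply: contra nba => /mapP[c _ ->]; apply: lem_addr.
Qed.

Lemma submultinom (m j : nat) (a : 'X_{1..m}) : (j <= mdeg a)%N ->
  exists2 b : 'X_{1..m}, (b <= a)%MM & mdeg b = j.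
Proof.
elim: j => [|j IH] ja.
  by exists 0%MM; [apply/mnm_lepP => i; rewrite mnm0E|apply: mdeg0].
have [b ba mb] := IH (ltnW ja).
have [i bi] : exists i, (b i < a i)%N.
  apply/existsP; apply: contraLR ja => /existsPn nba; rewrite -leqNgt -mb !mdegE.
  by apply: leq_sum => i _; rewrite leqNgt.
exists (b + U_(i))%MM; last by rewrite mdegD mdeg1 mb addn1.
apply/mnm_lepP => l; rewrite mnmDE mnm1E; case: (eqVneq i l) => [<-|_] /=.
  by rewrite addn1.
by rewrite addn0; apply/mnm_lepP.
Qed.

Section MonomialIdeal.
Variables (k : fieldType) (m : nat) (d : 'I_m -> nat).
Implicit Types (f z w p : {mpoly k[m]}) (a b : 'X_{1..m}).

Local Notation I := (gen_ideal (fun i : 'I_m => 'X_i ^+ d i : {mpoly k[m]})).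

Lemma ideal_mcoeff0 f a : f \in I -> (forall i, a i < d i)%N -> f@_a = 0.
Proof.
move=> /gen_idealP[c ->] ad; rewrite raddf_sum big1 //= => i _.
rewrite mpolyXn mcoeffMX_nle //; apply/negP => /mnm_lepP/(_ i).
by rewrite mulmnE mnm1E eqxx mul1n leqNgt ad.
Qed.

Lemma monomial_in_ideal a i : (d i <= a i)%N -> 'X_[a] \in I.
Proof.
move=> da; rewrite -(@submK _ (U_(i) *+ d i) a); last first.
  by apply/mnm_lepP => j; rewrite mulmnE mnm1E; case: eqP => [<-|_]; rewrite ?mul1n.
rewrite mpolyXD gen_idealMl //; apply/gen_idealP; exists (fun j => (j == i)%:R).
rewrite (bigD1 i) //= eqxx mul1r big1 ?addr0 -?mpolyXn // => j /negPf->.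
by rewrite mul0r.
Qed.

Lemma ideal_scale c f : f \in I -> c *: f \in I.
Proof. by move=> fI; rewrite -mul_mpolyC gen_idealMl. Qed.

Lemma reduced_monomial f : f \notin I ->
  exists2 a, a \in msupp f & forall i, (a i < d i)%N.
Proof.
move=> fI.
have /hasP[a af /forallP ad] : has (fun a => [forall i, a i < d i]%N) (msupp f).
  apply: contraR fI => /hasPn nf; rewrite [f]mpolyE big_seq rpred_sum // => a /nf.
  rewrite negb_forall => /existsP[i]; rewrite -leqNgt.
  by move=> /monomial_in_ideal/ideal_scale; apply.
by exists a.
Qed.

(** The quotient is Gorenstein: a surviving monomial [x^a] of [z] is completed to
    the socle monomial [\prod_i x_i^(d_i - 1)] by its complementary monomial, and
    no other monomial of [z] can contribute to that coefficient. *)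
Lemma socle_pairing j z : z \is j.-homog -> z \notin I ->
  exists a, z * 'X_[a] \notin I /\ (mdeg a + j = \sum_i (d i).-1)%N.
Proof.
move=> zj zI; have [a az ad] := reduced_monomial zI.
pose D := [multinom (d i).-1 | i < m].
have aD : (a <= D)%MM by apply/mnm_lepP => i; rewrite mnmE; have := ad i; lia.
exists (D - a)%MM; split.
  apply/negP => /(ideal_mcoeff0 (a := (D - a + a)%MM)).
  rewrite mcoeffMX => z0; move: az; rewrite mcoeff_msupp z0 ?eqxx // => i.
  by rewrite submK // mnmE; have := ad i; lia.
have <- : mdeg a = j by apply: (dhomog_mf zj).
rewrite -mdegD submK // mdegE; apply: eq_bigr => i _; exact: mnmE.
Qed.

Local Notation A := (mci k d).
Local Notation piA := (\pi_(mci k d))%qT.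
Local Notation deg := (@mci_degree k m d).

Definition maximal_rank f i : Prop :=
  (forall x y : A, deg i x -> deg i y -> piA f * x = piA f * y -> x = y) \/
  (forall y : A, deg i.+1 y -> exists2 x, deg i x & piA f * x = y).

(** A kernel element [z] below the middle degree excludes injectivity. It excludes
    surjectivity as well: surjectivity in degree [j] puts every monomial of degree
    above [j] in the ideal of [f] modulo the relations, in particular the
    complementary monomial [x^a] of [z], so that [z * x^a] would vanish because
    [f * z] does. *)
Lemma kernel_obstruction f z j :
  z \is j.-homog -> z \notin I -> f * z \in I -> (j.*2 < \sum_i (d i).-1)%N ->
  ~ maximal_rank f j.
Proof.
move=> zj zI fzI js [inj|surj].
  case/negP: zI; rewrite -[z]subr0; apply/gen_quot_eqP.
  apply: inj; [by exists z|by exists 0 => //; apply: rpred0|].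
  by rewrite -!(pi_gen_quot_monoid_morphism _).2 mulr0; apply/gen_quot_eqP; rewrite subr0.
have [a [zaI sa]] := socle_pairing zj zI.
have [b ba bj] : exists2 b, (b <= a)%MM & mdeg b = j.+1 by apply: submultinom; lia.
have [|x [x' _ x'x] fx] := surj (piA 'X_[b]).
  by exists 'X_[b] => //; rewrite dhomogX; apply/eqP.
case/negP: zaI; rewrite -(submK ba) mpolyXD.
have fxb : f * x' - 'X_[b] \in I.
  by apply/gen_quot_eqP; rewrite (pi_gen_quot_monoid_morphism _).2 x'x.
have -> : z * ('X_[a - b] * 'X_[b]) =
   'X_[a - b] * x' * (f * z) - z * 'X_[a - b] * (f * x' - 'X_[b]) by ring.
by rewrite rpredB // gen_idealMl.
Qed.

(** Multiplying [w] by the largest power of [f] that does not kill it gives a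
    kernel element; this avoids computing any power of [f] explicitly. *)
Lemma power_obstruction f w j t :
  f \is 1.-homog -> w \is j.-homog -> w \notin I -> f ^+ t * w \in I ->
  ((j + t).-1.*2 < \sum_i (d i).-1)%N ->
  ~ forall i, maximal_rank f i.
Proof.
move=> f1 wj wI ftI js maxrank.
have ex : exists t, f ^+ t * w \in I by exists t.
case: (ex_minnP ex) => -[|s] fsI mins; first by rewrite expr0 mul1r (negPf wI) in fsI.
have st := mins t ftI.
apply: (@kernel_obstruction f (f ^+ s * w) (s + j)) (maxrank _).
- by rewrite dhomogM //; have := dhomogMn s f1; rewrite mul1n.
- by apply/negP => /mins; rewrite ltnn.
- by rewrite mulrA -exprS.
- by apply: leq_trans js; lia.
Qed.

(** * Factorial rescaling and Frobenius twist *)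

Section FrobeniusTwist.
Variables (q : nat) (e off : 'I_m -> nat) (g : 'I_m -> k).

(** [twist] rescales the basis vector [x^a] by [\prod_i (e_i - a_i)!], turning the
    lowering operator of sl_2 into plain multiplication by a linear form, then
    raises all variables to the power [q] and multiplies by [\prod_i x_i^(off_i)]. *)
Definition twist_coeff a : k := (\prod_i (e i - a i)`!)%:R.
Definition twist_exp a := [multinom (q * a i + off i)%N | i < m].
Definition twist p := \sum_(a <- msupp p) (p@_a * twist_coeff a) *: 'X_[twist_exp a].

Lemma twistwE K p : (msize p <= K)%N ->
  twist p = \sum_(a : 'X_{1..m < K}) (p@_a * twist_coeff a) *: 'X_[twist_exp a].
Proof.
pose J : subFinType _ := 'X_{1..m < K}.
move=> pK; rewrite /twist (big_mksub J) /=; first last.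
- by move=> a /msize_mdeg_lt/leq_trans/(_ pK).
- by rewrite msupp_uniq.
by rewrite big_rmcond //= => a /memN_msupp_eq0 ->; rewrite mul0r scale0r.
Qed.

Lemma twist_is_linear : linear twist.
Proof.
move=> c p1 p2; pose K := maxn (msize (c *: p1 + p2)) (maxn (msize p1) (msize p2)).
rewrite !(@twistwE K) ?leq_max ?leqnn ?orbT // scaler_sumr -big_split /=.
by apply: eq_bigr => a _; rewrite mcoeffD mcoeffZ scalerA mulrDl scalerDl mulrA.
Qed.

HB.instance Definition _ := GRing.isLinear.Build k {mpoly k[m]} {mpoly k[m]}
  _ twist twist_is_linear.

Lemma twistX a : twist 'X_[a] = twist_coeff a *: 'X_[twist_exp a].
Proof. by rewrite /twist msuppX big_seq1 mcoeffX eqxx mul1r. Qed.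

Lemma mcoeff_twist a p : (0 < q)%N -> (twist p)@_(twist_exp a) = p@_a * twist_coeff a.
Proof.
move=> q0; rewrite raddf_sum /=.
have expI b : (twist_exp b == twist_exp a) = (b == a).
  apply/eqP/eqP => [/mnmP ba|->//]; apply/mnmP => i; move: (ba i); rewrite !mnmE.
  by move/addIn/eqP; rewrite eqn_pmul2l // => /eqP.
have [ap|/memN_msupp_eq0 pa] := boolP (a \in msupp p).
  rewrite (bigD1_seq a) //= mcoeffZ mcoeffX eqxx mulr1 big1 ?addr0 // => b /negPf ba.
  by rewrite mcoeffZ mcoeffX expI ba mulr0.
rewrite pa mul0r big1 // => b _; rewrite mcoeffZ mcoeffX expI.
by case: eqP => [->|_]; rewrite ?pa ?mul0r ?mulr0.
Qed.

Lemma twist_homog p N : p \is N.-homog -> twist p \is (q * N + \sum_i off i)%N.-homog.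
Proof.
move=> /dhomogP pN; rewrite /twist big_seq rpred_sum // => a /pN aN.
apply: rpredZ; rewrite dhomogX; apply/eqP; rewrite -aN /= !mdegE big_distrr -big_split /=.
by apply: eq_bigr => i _; rewrite mnmE.
Qed.

(** Distinct monomials have distinct twists, so the leading monomial of [p]
    survives: it stays below the exponents [d], and its coefficient is multiplied
    by factorials that are units in [k]. *)
Lemma twist_notin p : (0 < q)%N -> (forall a, a \in msupp p -> forall i, a i <= e i)%N ->
  (forall i, q * e i + off i < d i)%N ->
  (forall i n, (n <= e i)%N -> n`!%:R != 0 :> k) ->
  p != 0 -> twist p \notin I.
Proof.
move=> q0 le_e ltd fact0 p0; have ap := mlead_supp p0.
apply/negP => /(ideal_mcoeff0 (a := twist_exp (mlead p))).
rewrite mcoeff_twist // => coef0.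
suff : p@_(mlead p) * twist_coeff (mlead p) != 0.
  rewrite coef0 ?eqxx // => i; rewrite mnmE; apply: leq_ltn_trans (ltd i).
  by rewrite leq_add2r leq_mul2l le_e ?orbT.
rewrite mulf_neq0 -?mcoeff_msupp // /twist_coeff natr_prod.
by apply/prodf_neq0 => i _; apply: (fact0 i); apply: leq_subr.
Qed.

Definition sl2_lowering p :=
  \sum_i g i *: (('X_i * p) *+ e i - 'X_i ^+ 2 * p^`M(i)).

Lemma sl2_loweringE p :
  sl2_lowering p = (\sum_i (g i *: 'X_i) *+ e i) * p - quadratic_field g p.
Proof.
rewrite /quadratic_field mulr_suml -sumrB; apply: eq_bigr => i _.
by rewrite scalerBr mulrnAl -scalerAl scalerMnr.
Qed.

Lemma sl2_lowering_is_linear : linear sl2_lowering.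
Proof.
move=> c p1 p2; rewrite /sl2_lowering scaler_sumr -big_split /=; apply: eq_bigr => i _.
rewrite mderivD mderivZ -!mul_mpolyC; ring.
Qed.

HB.instance Definition _ := GRing.isLinear.Build k {mpoly k[m]} {mpoly k[m]}
  _ sl2_lowering sl2_lowering_is_linear.

Lemma sl2_loweringX a : sl2_lowering 'X_[a] =
  \sum_i (g i * ((e i)%:R - (a i)%:R)) *: 'X_[a + U_(i)].
Proof.
apply: eq_bigr => i _; rewrite -scalerA; congr (_ *: _).
rewrite mderivX -scalerAr scalerBl !scaler_nat; congr (_ - _).
  by rewrite mpolyXD mulrC.
have [->|a0] := eqVneq (a i) 0%N; first by rewrite !mulr0n.
rewrite expr2 -!mpolyXD; congr ('X_[_] *+ _); apply/mnmP => j.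
by rewrite !mnmDE mnmBE mnm1E; case: (i =P j) => [<-|_] /=; lia.
Qed.

(** As long as [x^a x_i] stays in the box of exponents at most [e], this is the
    identity [(e_i - a_i)! = (e_i - a_i) (e_i - a_i - 1)!]. Otherwise both terms are
    multiples of the twisted monomial of [x^a x_i], which lies in the ideal. *)
Lemma twist_loweringX a i : (forall j, d j <= q * (e j).+1 + off j)%N ->
  'X_i ^+ q * twist 'X_[a] - ((e i)%:R - (a i)%:R) *: twist 'X_[a + U_(i)] \in I.
Proof.
move=> dle; rewrite !twistX.
have -> : 'X_i ^+ q * (twist_coeff a *: 'X_[twist_exp a]) =
    twist_coeff a *: 'X_[twist_exp (a + U_(i))] :> {mpoly k[m]}.
  rewrite -scalerAr mpolyXn -mpolyXD; congr (_ *: 'X_[_]); apply/mnmP => j.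
  by rewrite mnmDE mulmnE !mnmE; lia.
have [le_e|/forallPn[j]] := boolP [forall j, (a + U_(i))%MM j <= e j]%N; last first.
  rewrite -ltnNge => ej.
  have XI : 'X_[twist_exp (a + U_(i))] \in I.
    apply: (monomial_in_ideal (i := j)); rewrite mnmE; apply: leq_trans (dle j) _.
    by rewrite leq_add2r leq_mul2l ej orbT.
  by rewrite rpredB ?ideal_scale.
have ai : (a i < e i)%N.
  by have /forallP/(_ i) := le_e; rewrite mnmDE mnm1E eqxx addn1.
suff -> : twist_coeff a = ((e i)%:R - (a i)%:R) * twist_coeff (a + U_(i)).
  by rewrite scalerA subrr rpred0.
rewrite -natrB ?(ltnW ai) // -natrM; congr (_%:R).
rewrite (bigD1 i) //= [in RHS](bigD1 i) //= mnmDE mnm1E eqxx mulnA; congr (_ * _)%N.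
  by rewrite addn1 subnS -[in LHS](@prednK (e i - a i)) ?factS ?prednK ?subn_gt0.
by apply: eq_bigr => j ji; rewrite mnmDE mnm1E eq_sym (negPf ji) addn0.
Qed.

(** The twist intertwines the lowering operator with multiplication by
    [\sum_i g_i x_i^q], which is the [q]-th power of a linear form. *)
Lemma twist_lowering p : (forall i, d i <= q * (e i).+1 + off i)%N ->
  (\sum_i g i *: 'X_i ^+ q) * twist p - twist (sl2_lowering p) \in I.
Proof.
move=> dle; elim/mpolyind: p => [|c a p _ _ IH].
  by rewrite !linear0 mulr0 ?subr0 ?addr0 rpred0.
set F := \sum_i _.
have -> : F * twist (c *: 'X_[a] + p) - twist (sl2_lowering (c *: 'X_[a] + p)) =
    c *: (F * twist 'X_[a] - twist (sl2_lowering 'X_[a])) +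
    (F * twist p - twist (sl2_lowering p)).
  rewrite sl2_lowering_is_linear !twist_is_linear -!mul_mpolyC; ring.
rewrite rpredD // ideal_scale // sl2_loweringX (linear_sum twist) mulr_suml -sumrB.
rewrite rpred_sum // => i _.
rewrite (linearZ_LR twist) /= -scalerAl -scalerA -scalerBr.
by rewrite ideal_scale // twist_loweringX.
Qed.

End FrobeniusTwist.

End MonomialIdeal.

(** * Powers of linear forms *)

Section LinearForm.
Variables (k : fieldType) (m : nat).
Implicit Types f : {mpoly k[m]}.

Lemma linear_formE f : f \is 1.-homog -> f = \sum_i f@_U_(i) *: 'X_i.
Proof.
move=> f1; apply/mpolyP => a; rewrite raddf_sum /=.
have [/mdeg1P[i /eqP->]|a1] := boolP (mdeg a == 1%N).
  rewrite (bigD1 i) //= mcoeffZ mcoeffXU eqxx mulr1 big1 ?addr0 // => j ji.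
  by rewrite mcoeffZ mcoeffXU (negPf ji) mulr0.
rewrite (dhomog_nemf_coeff f1) // big1 // => i _; rewrite mcoeffZ mcoeffX.
case: (_ =P a) => [ia|_]; last by rewrite mulr0.
by rewrite -ia mdeg1 in a1.
Qed.

(** Additivity of the Frobenius, applied to a linear form. *)
Lemma linear_form_frobenius (p q : nat) f : p \in [pchar k] -> p.-nat q ->
  f \is 1.-homog -> f ^+ q = \sum_i f@_U_(i) ^+ q *: 'X_i ^+ q.
Proof.
move=> pk pq f1; idtac.
have qk : [pchar {mpoly k[m]}].-nat q.
  apply: sub_in_pnat pq => l _ /eqP ->; rewrite inE (pcharf_prime pk) /=.
  by rewrite -mpolyC_nat (pcharf0 pk).
rewrite {1}(linear_formE f1).
elim/big_rec2: _ => [|i y1 y2 _ <-].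
  by case: q pq {qk} => // q _; rewrite expr0n.
by rewrite exprDn_pchar // exprZn.
Qed.

End LinearForm.

(** If [q] is a power of the characteristic that bounds all exponents, then [f^q]
    vanishes, so the last nonzero power of [f] is a kernel element. *)
Lemma nilpotent_obstruction (k : fieldType) (m p q : nat) (d : 'I_m -> nat)
    (f : {mpoly k[m]}) :
  p \in [pchar k] -> p.-nat q -> f \is 1.-homog ->
  (forall i, 0 < d i <= q)%N -> (q.-1.*2 < \sum_i (d i).-1)%N ->
  ~ forall i, maximal_rank d f i.
Proof.
move=> pk pq f1 dq deg; apply: (power_obstruction (w := 1) (j := 0) (t := q)) => //.
- exact: dhomog1.
- apply/negP => /(ideal_mcoeff0 (a := 0%MM)) c0; have /eqP := @oner_neq0 k; apply.
  rewrite -c0 ?mcoeff1 ?eqxx // => i; rewrite mnm0E; by case/andP: (dq i).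
rewrite mulr1 (linear_form_frobenius pk pq f1) rpred_sum // => i _; apply: ideal_scale.
rewrite mpolyXn; apply: (@monomial_in_ideal _ _ _ _ i).
by rewrite mulmnE mnm1E eqxx mul1n; case/andP: (dq i).
Qed.

(** The twist of [kernel_form], for the weights [g_i = c_i^q] where the [c_i] are the
    coefficients of [f], is killed by [f^q]. The degree bound says that it remains
    below the middle after multiplication by [f^(q-1)]. *)
Lemma frobenius_obstruction (k : fieldType) (m p q N : nat) (d e off : 'I_m -> nat)
    (f : {mpoly k[m]}) :
  p \in [pchar k] -> p.-nat q -> f \is 1.-homog ->
  (\sum_i e i = N.*2)%N -> (forall i, e i <= N)%N -> (forall i, e i < p)%N ->
  (forall i, d i <= q * (e i).+1 + off i)%N -> (forall i, q * e i + off i < d i)%N ->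
  ((q * N + \sum_i off i + q).-1.*2 < \sum_i (d i).-1)%N ->
  ~ forall i, maximal_rank d f i.
Proof.
move=> pk pq f1 sum_e eN ep dle ltd deg.
have q0 : (0 < q)%N by case/andP: pq.
have [P [P0 PN Pe DP]] := kernel_form (fun i => f@_U_(i) ^+ q) sum_e eN.
apply: (power_obstruction (w := twist q e off P) (t := q)) deg => //.
- exact: twist_homog.
- apply: twist_notin => // i j je.
  rewrite -(dvdn_pcharf pk); have := leq_ltn_trans je (ep i).
  elim: j {je} => [_|j IH jp].
    by rewrite dvdn1 neq_ltn prime_gt1 ?orbT ?(pcharf_prime pk).
  by rewrite factS Euclid_dvdM ?(pcharf_prime pk) // negb_or gtnNdvd //= IH // ltnW.
rewrite (linear_form_frobenius pk pq f1).
have := twist_lowering (fun i => f@_U_(i) ^+ q) P dle.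
by rewrite sl2_loweringE DP subrr linear0 subr0.
Qed.

(** * Numerical choices *)

(** Here [c i * q + r i] plays the role of [d i] in [frobenius_obstruction]. *)
Definition admissible_exponents (m q : nat) (c r e off : 'I_m -> nat) (N : nat) :=
  [/\ (\sum_i e i = N.*2)%N, forall i, (e i <= N)%N, forall i, (e i <= c i)%N,
      forall i, (c i * q + r i <= q * (e i).+1 + off i)%N /\
                (q * e i + off i < c i * q + r i)%N &
      ((q * N + \sum_i off i + q).-1.*2 < \sum_i (c i * q + r i).-1)%N].

(** For each [i] there are two candidates for [(e_i, off_i)], namely [(c_i - 1, r_i)]
    and [(c_i, 0)], whose contributions to the distance from the middle degree,
    doubled, are [q - 1 - r_i] and [r_i - 1]. With [q = 2h + 1] the better one
    contributes at least [h], and the total must reach [2q - 1 = 4h + 1]. If the sum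
    of the [e_i] has the wrong parity, one index with [r_j > 0] switches to its
    other candidate, which still contributes a nonnegative amount, and the other
    indices, at least five of them, contribute [5h]. If all [r_i] vanish there is no
    such index, and an index with [c_j >= 2] takes [(c_j - 2, q)] instead, which
    contributes [-1] while the others contribute [2h] each. The bound on the [c_i]
    makes every [e_i] at most half the sum. *)
Lemma exponent_choice (n q h : nat) (c r : 'I_n.+1 -> nat) :
  (5 <= n)%N -> (q = h.*2.+1)%N -> (0 < h)%N ->
  (forall i, 0 < c i)%N -> (forall i, r i < q)%N ->
  (forall i, (c i).*2 + n <= \sum_j c j + 1)%N ->
  exists e off N, admissible_exponents q c r e off N.
Proof.
move=> n5 qh h0 c0 rq cbound.
(* [s i - u i] bounds the doubled contribution of [i] from below. *)
have deg_bound e off N (s u : 'I_n.+1 -> nat) : (\sum_i e i = N.*2)%N ->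
    (forall i, q * e i + (off i).*2 + s i <= (c i * q + r i).-1 + u i)%N ->
    (2 * q + \sum_i u i <= \sum_i s i + 1)%N ->
    ((q * N + \sum_i off i + q).-1.*2 < \sum_i (c i * q + r i).-1)%N.
  move=> sum_e le_s.
  have : (\sum_i (q * e i + (off i).*2 + s i)
          <= \sum_i ((c i * q + r i).-1 + u i))%N.
    by apply: leq_sum => i _; apply: le_s.
  rewrite !big_split /= -big_distrr /= sum_e.
  have -> : (\sum_i (off i).*2 = (\sum_i off i).*2)%N.
    by rewrite -mul2n big_distrr; apply: eq_bigr => i _ /=; rewrite mul2n.
  by rewrite -doubleMr; move: (q * N)%N (\sum_i off i)%N => qN F; lia.
have sum_c i : (\sum_j c j = c i + \sum_(j | j != i) c j)%N by rewrite (bigD1 i).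
have sum1_but i : (\sum_(l : 'I_n.+1 | l != i) 1 = n)%N.
  by rewrite sum1_card cardC1 card_ord.
(* [T] selects the indices that take the candidate [(c i, 0)]. *)
have choice (T : pred 'I_n.+1) (j : 'I_n.+1) : (forall i, T i -> 0 < r i)%N ->
    (forall i, i != j -> T i = (h < r i)%N) ->
    ~~ odd (\sum_i (if T i then c i else (c i).-1)) ->
    exists e off N, admissible_exponents q c r e off N.
  move=> T0 Tj ev; pose e i := if T i then c i else (c i).-1.
  pose off i := if T i then 0%N else r i.
  have [N sum_e] : exists N, (\sum_i e i = N.*2)%N.
    by exists (\sum_i e i)./2; rewrite even_halfK.
  exists e, off, N; split=> // [i|i|i|].
  - have : (\sum_(l | l != i) c l <= \sum_(l | l != i) e l + n)%N.
      rewrite -[X in (_ <= _ + X)%N](sum1_but i) -big_split /=.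
      by apply: leq_sum => l _; rewrite /e; case: ifP; lia.
    have := cbound i; rewrite (sum_c i) => bound sum_le.
    move: sum_e; rewrite (bigD1 i) //=; have := c0 i.
    have : e i = if T i then c i else (c i).-1 by [].
    move: bound sum_le.
    move: (\sum_(l | l != i) e l)%N (\sum_(l | l != i) c l)%N => Se Sc.
    by case: (T i); lia.
  - by rewrite /e; case: ifP; lia.
  - have := T0 i; have := rq i; have := c0 i; rewrite /e /off.
    case: ifP => _ ? ? ?; last by nia.
    split; last by nia.
    by nia.
  - apply: (deg_bound e off _ (fun i => if i == j then 0%N else h) (fun=> 0%N))
      => // [i|].
      have := T0 i; have := rq i; have := c0 i; have := Tj i; rewrite /e /off.
      by case: (eqVneq i j) => [_|_ /(_ isT) ->]; case: ifP => Ti ? ? ?; nia.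
    rewrite big1_eq addn0 (bigD1 j) //= eqxx.
    rewrite (eq_bigr (fun=> h)) => [|i /negPf-> //].
    by rewrite !sum_nat_const cardC1 !card_ord /=; nia.
have [sum_odd|sum_even] := boolP (odd (\sum_i (if (h < r i)%N then c i else (c i).-1))); last first.
  by apply: (choice (fun i => h < r i)%N ord0) => // i; lia.
have [/existsP[j rj]|/existsPn r0] := boolP [exists j, (0 < r j)%N].
  apply: (choice (fun i => if i == j then ~~ (h < r i)%N else (h < r i)%N) j).
  - by move=> i; case: eqP => [->|_ /=]; lia.
  - by move=> i /negPf->.
  - move: sum_odd; rewrite (bigD1 j) //= [X in ~~ odd X](bigD1 j) //= eqxx.
    rewrite [X in ~~ odd (_ + X)]
      (eq_bigr (fun i => if (h < r i)%N then c i else (c i).-1)).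
      have := c0 j; case: (h < r j)%N => /=; lia.
    by move=> i /negPf->.
have {}r0 i : r i = 0%N by have := r0 i; lia.
have {}sum_odd : odd (\sum_i (c i).-1).
  by move: sum_odd; congr (odd _); apply: eq_bigr => i _; rewrite r0.
have [j cj] : exists j, (1 < c j)%N.
  apply/existsP; apply: contraLR sum_odd => /existsPn c1; rewrite big1 // => i _.
  by have := c1 i; lia.
pose N := (\sum_i (c i).-1)./2.
have sum_cN : (\sum_i (c i).-1 = N.*2.+1)%N by rewrite -[LHS]odd_double_half sum_odd.
exists (fun i => if i == j then (c i).-2 else (c i).-1).
exists (fun i => if i == j then q else 0%N), N.
have sum_e : (\sum_i (if i == j then (c i).-2 else (c i).-1) = N.*2)%N.
  move: sum_cN; rewrite (bigD1 j) //= [X in _ -> X = _](bigD1 j) //= eqxx.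
  rewrite [X in _ -> (_ + X = _)%N](eq_bigr (fun i => (c i).-1)) => [|i /negPf->//].
  lia.
have sum_c1 : (\sum_i c i = \sum_i (c i).-1 + n.+1)%N.
  have sum1 : (\sum_(i < n.+1) 1 = n.+1)%N by rewrite sum1_card card_ord.
  rewrite -[X in _ = (_ + X)%N]sum1 -big_split /=.
  by apply: eq_bigr => i _ /=; have := c0 i; lia.
split=> // [i|i|i|].
- by have := cbound i; case: ifP; lia.
- by case: ifP; lia.
- by have := c0 i; rewrite r0; case: eqP => [->|_] ?; split; nia.
apply: (deg_bound _ _ _ (fun i => if i == j then 0%N else h.*2) (fun i => (i == j) : nat))
  sum_e _ _ => [i|].
  by have := c0 i; rewrite r0; case: (eqVneq i j) => [->|_] ?; nia.
rewrite (bigD1 j) //= eqxx big1 => [|i /negPf-> //].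
rewrite (bigD1 j) //= eqxx (eq_bigr (fun=> h.*2)) => [|i /negPf-> //].
by rewrite sum_nat_const cardC1 card_ord /=; nia.
Qed.

Unset Implicit Arguments.
Set Strict Implicit.
Set Printing Implicit Defensive.

Theorem corollary5p5 (k : fieldType)
    (hinf : cardinality.infinite_set (@classical_sets.setT k))
    (p : nat) (hp : p \in [pchar k])
    (n : nat) (hn : (5 <= n)%N)
    (q e : nat) (hq : q = (p ^ e)%N)
    (d kk r : 'I_n.+1 -> nat)
    (hd : forall i, d i = (kk i * q + r i)%N)
    (hkk : forall i, (1 <= kk i <= p - 1)%N)
    (hr : forall i, (0 <= r i <= q - 1)%N)
    (hfloor : forall i, (kk i <= (\sum_(j < n.+1) kk j - n + 1) %/ 2)%N) :
  weak_Lefschetz (@mci_degree k n.+1 d) -> q = 1%N.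
Proof.
case=> _ [f f1 <-] maxrank.
have p_pr := pcharf_prime hp; have p_gt1 := prime_gt1 p_pr.
case: e hq => [-> //|e hq]; exfalso.
have pq : p.-nat q by rewrite hq pnatX pnat_id.
have pleq : (p <= q)%N by rewrite hq expnS leq_pmulr // expn_gt0 prime_gt0.
have k1 i : (0 < kk i)%N by case/andP: (hkk i).
have rq i : (r i < q)%N by have /andP[_] := hr i; lia.
(* In characteristic 2 every [kk i] is 1, so that [d i = q + r i]: the 2q-th power
   of a linear form vanishes, and so does the q-th power when all [r i] are 0. *)
have [p2|podd] := even_prime p_pr.
  have dE i : d i = (q + r i)%N.
    have /andP[k_ge k_le] := hkk i; rewrite hd (_ : kk i = 1%N) ?mul1n //.
    by move: k_le; rewrite p2; lia.
  have [/existsP[j rj]|/existsPn r0] := boolP [exists j, (0 < r j)%N].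
    apply: (@nilpotent_obstruction k _ p (p * q) d f) maxrank => //.
    - by rewrite pnatM pnat_id.
    - by move=> i; rewrite dE; have := rq i; lia.
    rewrite (bigD1 j) //= dE.
    have : (\sum_(i < n.+1 | i != j) q.-1 <= \sum_(i < n.+1 | i != j) (d i).-1)%N.
      by apply: leq_sum => i _; rewrite dE; lia.
    rewrite sum_nat_const cardC1 card_ord p2 /=.
    have : (5 * q.-1 <= n * q.-1)%N by rewrite leq_mul2r hn orbT.
    move: pleq rj; rewrite p2.
    by move: (\sum_(i | i != j) (d i).-1)%N (n * q.-1)%N => S nq; lia.
  apply: (@nilpotent_obstruction k _ p q d f) maxrank => //.
    by move=> i; rewrite dE; have := r0 i; lia.
  have : (\sum_(i < n.+1) q.-1 <= \sum_(i < n.+1) (d i).-1)%N.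
    by apply: leq_sum => i _; rewrite dE; lia.
  rewrite sum_nat_const card_ord.
  have : (5 * q.-1 <= n.+1 * q.-1)%N by rewrite leq_mul2r (leqW hn) orbT.
  move: pleq; rewrite p2; move: (\sum_i (d i).-1)%N (n.+1 * q.-1)%N => S nq; lia.
have qodd : odd q by rewrite hq oddX podd orbT.
have qE : q = (q./2.*2.+1)%N by rewrite -[LHS]odd_double_half qodd.
have cbound i : ((kk i).*2 + n <= \sum_j kk j + 1)%N.
  have := hfloor i; rewrite leq_divRL // => bound.
  have : (\sum_(j < n.+1) 1 <= \sum_(j < n.+1) kk j)%N by apply: leq_sum.
  by rewrite sum1_card card_ord; move: bound; move: (\sum_j kk j)%N => S; lia.
have h0 : (0 < q./2)%N by lia.
have [a [b [N [sum_a aN ak ab deg]]]] := exponent_choice hn qE h0 k1 rq cbound.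
apply: (@frobenius_obstruction k _ p q N d a b f) maxrank => //.
- by move=> i; have := ak i; have := hkk i; lia.
- by move=> i; rewrite hd; case: (ab i).
- by move=> i; rewrite hd; case: (ab i).
- by under [X in (_ < X)%N]eq_bigr do rewrite hd.
Qed.
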